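(* Let $G$ be a complete multipartite graph with independence number $m\geq 2$ and let $k_p$ denote the number of parts of $G$ of cardinality $p$ for $1\leq p\leq m$. If $$k_1-\sum_{p=2}^m\left(\frac{p^2}{2}-\frac{3p}{2}+1\right)k_p\geq 0,$$ then $G$ is on-line chromatic-choosable, i.e. $\chi_p(G)=\chi(G)$.
   Context: All graphs are finite and simple. The parts of a complete multipartite graph are its partite sets. $\chi(G)$ is the chromatic number. On-line $f$-list coloring game. Given a graph $G$ and an integer-valued function $f$ on $V(G)$, two players Alice and Bob play as follows. Initially all vertices are uncolored. In round $i$, Alice marks a nonempty subset $V_i$ of the remaining uncolored vertices (assigning color $i$ as a permissible color to each vertex of $V_i$); then Bob chooses an independent set $X_i\subseteq V_i$ and colors all vertices of $X_i$ with color $i$. If at the end of some round there is a vertex $v$ that has been marked $f(v)$ times but is not yet colored, Alice wins. Otherwise Bob wins, i.e. in the end each vertex $v$ is colored by Bob before running out of $f(v)$ permissible colors. $G$ is on-line $f$-choosable if Bob has a winning strategy, and on-line $k$-choosable if this holds for the constant function $f\equiv k$. The on-line choice number $\chi_p(G)$ (the subscript $p$ here is just notation) is the minimum $k$ such that $G$ is on-line $k$-choosable. $G$ is on-line chromatic-choosable if $\chi_p(G)=\chi(G)$. *)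

(* Defs.v *)
From mathcomp Require Import all_boot all_order all_algebra.
From mathcomp Require Import boolp.

Set Implicit Arguments.
Unset Strict Implicit.
Unset Printing Implicit Defensive.

Import Order.TTheory GRing.Theory Num.Theory.

Definition simple_graph (T : finType) (e : rel T) : Prop :=
  symmetric e /\ irreflexive e.

Definition independent (T : finType) (e : rel T) (S : {set T}) : bool :=
  [forall x in S, forall y in S, ~~ e x y].

Definition independence_number (T : finType) (e : rel T) : nat :=
  \max_(S : {set T} | independent e S) #|S|.

Definition complete_multipartite (T : finType) (e : rel T)
    (P : {set {set T}}) : Prop :=
  partition P [set: T] /\ forall x y, e x y = (pblock P x != pblock P y).

Definition parts_of_size (T : finType) (P : {set {set T}}) (p : nat) : nat :=
  #|[set B in P | #|B| == p]|.

Definition colorable (T : finType) (e : rel T) (k : nat) : bool :=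
  [exists c : {ffun T -> 'I_k}, forall x, forall y, e x y ==> (c x != c y)].

(* Irreflexivity is needed for a proper coloring to exist at all, so the
   chromatic number takes the graph axioms as an argument. *)
Lemma colorable_exists (T : finType) (e : rel T) :
  simple_graph e -> exists k, colorable e k.
Proof.
case=> _ irr_e; exists #|T|; apply/existsP; exists [ffun x => enum_rank x].
apply/forallP => x; apply/forallP => y; apply/implyP; rewrite !ffunE.
by apply: contraTneq => /enum_rank_inj ->; rewrite irr_e.
Qed.

Definition chromatic_number (T : finType) (e : rel T)
    (He : simple_graph e) : nat := ex_minn (colorable_exists He).

(* A history is the sequence V_1, ..., V_i of the sets marked by Alice so far;
   a strategy of Bob maps it to his answer X_i in round i.  Its value on the
   empty history is never used. *)
Definition strategy (T : finType) : Type := seq {set T} -> {set T}.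

Definition uncolored (T : finType) (s : strategy T) (h : seq {set T}) :
    {set T} := ~: \bigcup_(i < size h) s (take i.+1 h).

Definition marks (T : finType) (h : seq {set T}) (v : T) : nat :=
  count (fun V : {set T} => v \in V) h.

Definition legal_history (T : finType) (s : strategy T) (h : seq {set T}) :
    Prop :=
  forall i, i < size h ->
    nth set0 h i != set0 /\ nth set0 h i \subset uncolored s (take i h).

Definition legal_strategy (T : finType) (e : rel T) (s : strategy T) : Prop :=
  forall h V, legal_history s (rcons h V) ->
    s (rcons h V) \subset V /\ independent e (s (rcons h V)).

(* Quantifying over all histories tests the position at the end of every round.
   The empty history is included: a vertex with f v <= 0 has no permissible
   color at all, so Bob cannot win.  Requiring that no uncolored v ever reaches
   f v marks bounds the length of every play, so that each play ends, with all
   vertices colored. *)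
Definition winning_strategy (T : finType) (e : rel T) (f : T -> int)
    (s : strategy T) : Prop :=
  legal_strategy e s /\
  forall h, legal_history s h ->
    forall v, v \in uncolored s h -> ((marks h v)%:Z < f v)%R.

Definition online_f_choosable (T : finType) (e : rel T) (f : T -> int) : Prop :=
  exists s : strategy T, winning_strategy e f s.

Definition online_choosable (T : finType) (e : rel T) (k : nat) : Prop :=
  online_f_choosable e (fun=> k%:Z%R).

Lemma uncolored_rcons (T : finType) (s : strategy T) (h : seq {set T})
    (V : {set T}) :
  uncolored s (rcons h V) = uncolored s h :\: s (rcons h V).
Proof.
rewrite /uncolored size_rcons big_ord_recr /=.
rewrite [take (size h).+1 _]take_oversize ?size_rcons // setCU setDE.
congr (~: _ :&: _); apply: eq_bigr => i _.
by rewrite -cats1 takel_cat.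
Qed.

Lemma legal_history_rcons (T : finType) (s : strategy T) (h : seq {set T})
    (V : {set T}) :
  legal_history s (rcons h V) ->
  [/\ legal_history s h, V != set0 & V \subset uncolored s h].
Proof.
move=> legal; split.
- move=> i lti; have := legal i; rewrite size_rcons ltnS (ltnW lti) nth_rcons.
  by rewrite lti -cats1 take_cat lti => /(_ isT).
- by have [] := legal (size h); rewrite ?size_rcons // nth_rcons ltnn eqxx.
- have [] := legal (size h); rewrite ?size_rcons // nth_rcons ltnn eqxx.
  by rewrite -cats1 take_size_cat.
Qed.

(* Bob colors one marked vertex per round: a vertex that is still uncolored has
   been marked at most as often as other vertices have been colored. *)
Lemma online_choosable_exists (T : finType) (e : rel T) :
  simple_graph e -> exists k, `[< online_choosable e k >].
Proof.
case=> _ irr_e; exists #|T|; apply/asboolP.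
pose s : strategy T := fun h =>
  if [pick x in last set0 h] is Some x then [set x] else set0.
exists s; split=> [h V _|].
  rewrite /s last_rcons; case: pickP => [x xV | _]; last first.
    by rewrite sub0set; split=> //; apply/forallP => x; rewrite inE.
  rewrite sub1set; split=> //; apply/forallP => y; apply/implyP => /set1P ->.
  by apply/forallP => z; apply/implyP => /set1P ->; rewrite irr_e.
have bound h : legal_history s h -> size h + #|uncolored s h| <= #|T|.
  elim/last_ind: h => [|h V IHh]; first by rewrite add0n max_card.
  case/legal_history_rcons => /IHh leh /set0Pn[x xV] /subsetP sVU.
  rewrite uncolored_rcons size_rcons /s last_rcons.
  case: pickP => [y /sVU yU | /(_ x)]; last by rewrite xV.
  by move: leh; rewrite [in X in X -> _](cardsD1 y) yU addnA addn1.
move=> h /bound leh v vU; rewrite ltz_nat; apply: leq_trans leh.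
rewrite -addn1 leq_add ?count_size //.
by apply/card_gt0P; exists v.
Qed.

Definition online_choice_number (T : finType) (e : rel T)
    (He : simple_graph e) : nat := ex_minn (online_choosable_exists He).

Definition online_chromatic_choosable (T : finType) (e : rel T)
    (He : simple_graph e) : Prop :=
  online_choice_number He = chromatic_number He.

(* Main.v *)
(* Bob sorts the uncoloured vertices into two groups: remainders B with at least
   two vertices of a part, and singles, each carrying a class and linearly
   ordered by decreasing class.  He guarantees that a single v of class j has at
   least
     sum_B max(|B| - j, 1) + (position of v)
   permissible colours left, and that any i > 0 vertices of one remainder
   jointly have at least
     #remainders
     + sum_(1 <= l < i) (sum_B max(|B| - l, 1) + #singles of class >= l).
   If a whole remainder is marked he colours it.  If some marked set attains its
   bound, he takes a largest such set S and colours everything marked in its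
   remainder; the vertices left there have many colours and become the last
   singles of class |S|.  Otherwise no marked set is tight; let r be the largest
   number of marked vertices in a remainder.  He colours the first marked single
   of class >= r or, failing that, r marked vertices of one remainder; if only
   one vertex is left there, it becomes the first single, in the top class.
   With chi(G) colours per vertex and all singles in the top class, the initial
   inequalities follow from k_1 >= sum_p binomial(p - 1, 2) k_p, which is the
   hypothesis. *)

Require Import Defs.
From mathcomp Require Import all_boot all_order all_algebra.
From mathcomp Require Import boolp zify lra.

Set Implicit Arguments.
Unset Strict Implicit.
Unset Printing Implicit Defensive.

Import Order.TTheory GRing.Theory Num.Theory.

(** * From an invariant to a winning strategy *)

Section StrategyFromInvariant.
Variables (T : finType) (e : rel T).
Variable inv : {set T} -> (T -> nat) -> Prop.

Definition spend (U : {set T}) (f : T -> nat) (v : T) : nat := f v - (v \in U).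

Hypothesis inv_pos : forall W f v, inv W f -> v \in W -> 0 < f v.
Hypothesis inv_step : forall (W U : {set T}) f,
  inv W f -> U \subset W -> U != set0 ->
  exists X : {set T}, [/\ X \subset U, independent e X & inv (W :\: X) (spend U f)].

(** Any answer that preserves the invariant will do; the default [set0] is never reached in legal
    play that starts from the invariant. *)
Definition reply (p : {set T} * (T -> nat)) (U : {set T}) : {set T} :=
  odflt set0 [pick X : {set T} | [&& X \subset U, independent e X &
    `[< inv (p.1 :\: X) (spend U p.2) >]]].

Definition next (p : {set T} * (T -> nat)) (U : {set T}) :=
  (p.1 :\: reply p U, spend U p.2).

(** A strategy sees only the marked sets, so the position before the current round is recomputed by
    folding over the history without its last set. *)
Definition inv_strategy p0 : strategy T := fun h =>
  reply (foldl next p0 (take (size h).-1 h)) (last set0 h).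

Lemma inv_strategy_rcons p0 h V :
  inv_strategy p0 (rcons h V) = reply (foldl next p0 h) V.
Proof.
by rewrite /inv_strategy size_rcons last_rcons /= -cats1 take_size_cat.
Qed.

Lemma foldl_next k h :
  let p0 := ([set: T], fun _ : T => k) in
  (foldl next p0 h).1 = uncolored (inv_strategy p0) h /\
  (foldl next p0 h).2 =1 fun v => k - marks h v.
Proof.
elim/last_ind: h => [|h V [IH1 IH2]] /=.
  by split=> [|v]; rewrite /uncolored /marks ?subn0 // big_ord0 setC0.
rewrite foldl_rcons /= uncolored_rcons inv_strategy_rcons -IH1; split=> // v.
by rewrite /spend IH2 /marks -cats1 count_cat /= addn0 subnDA.
Qed.

Lemma inv_online_choosable k : inv [set: T] (fun=> k) -> online_choosable e k.
Proof.
move=> inv0; pose p0 := ([set: T], fun _ : T => k).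
have invP h : legal_history (inv_strategy p0) h ->
    inv (foldl next p0 h).1 (foldl next p0 h).2.
  elim/last_ind: h => [//|h V IHh] /legal_history_rcons[/IHh invh V0 sVW].
  rewrite foldl_rcons /= /reply; case: pickP => [X /and3P[_ _ /asboolP//]|noX].
  have := foldl_next k h; rewrite -/p0 /= => -[W_h _].
  rewrite -W_h in sVW; have [X [sXV iX invX]] := inv_step invh sVW V0.
  by have := noX X; rewrite sXV iX asboolT.
exists (inv_strategy p0); split=> [h V _|h legal_h v vW].
  rewrite inv_strategy_rcons /reply; case: pickP => [X /and3P[]//|_] /=.
  by rewrite sub0set; split=> //; apply/forallP => x; rewrite inE.
have := foldl_next k h; rewrite -/p0 /= => -[W_h f_h].
by have := inv_pos (invP h legal_h); rewrite W_h => /(_ v vW); rewrite f_h subn_gt0.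
Qed.

End StrategyFromInvariant.

(** * The chromatic number as a lower bound *)

Section LowerBound.
Variables (T : finType) (e : rel T) (s : strategy T).

Fixpoint mark_all n :=
  if n is n'.+1 then rcons (mark_all n') (uncolored s (mark_all n')) else [::].

Lemma uncolored_mark_allS n :
  uncolored s (mark_all n.+1) \subset uncolored s (mark_all n).
Proof. by rewrite /= uncolored_rcons subsetDl. Qed.

Lemma legal_history_rconsI h V : legal_history s h -> V != set0 ->
  V \subset uncolored s h -> legal_history s (rcons h V).
Proof.
move=> legal_h V0 sVW i; rewrite size_rcons ltnS => le_i.
rewrite nth_rcons -cats1 takel_cat //; case: ltngtP le_i => // [lt_i|->] _.
  exact: legal_h.
by rewrite take_size.
Qed.

Lemma legal_mark_all n :
  (forall i, i < n -> uncolored s (mark_all i) != set0) ->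
  legal_history s (mark_all n).
Proof.
elim: n => [_ i //|n IHn nz]; apply: legal_history_rconsI; rewrite ?nz //.
by apply: IHn => i lt_i; rewrite nz // ltnW.
Qed.

Lemma uncolored_mark_all_sub m n :
  m <= n -> uncolored s (mark_all n) \subset uncolored s (mark_all m).
Proof.
move/subnK <-; elim: (n - m) => [//|d IHd].
exact: subset_trans (uncolored_mark_allS _) IHd.
Qed.

Lemma marks_mark_all n v :
  v \in uncolored s (mark_all n) -> marks (mark_all n) v = n.
Proof.
elim: n => [//|n IHn] vW; have vW' := subsetP (uncolored_mark_allS n) v vW.
by rewrite /marks /= -cats1 count_cat /= vW' [count _ _]IHn // addn1.
Qed.

(* Alice marks all uncoloured vertices in every round; the round in which Bob
   colours a vertex is then a proper colouring. *)
Lemma winning_colorable k :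
  winning_strategy e (fun=> k%:Z%R) s -> colorable e k.
Proof.
case=> legal_s win.
have nzP n v : v \in uncolored s (mark_all n) -> legal_history s (mark_all n.+1).
  move=> vW; apply: legal_mark_all => i; rewrite ltnS => le_in.
  by apply/set0Pn; exists v; apply: (subsetP (uncolored_mark_all_sub le_in)).
have all_colored v : exists n, v \notin uncolored s (mark_all n).
  exists k; apply/negP => vW; have /legal_history_rcons[legal_k _ _] := nzP _ _ vW.
  by have := win _ legal_k v vW; rewrite marks_mark_all // ltxx.
(* Every vertex is uncoloured at the start, so the least such [n] is positive; its predecessor is
   the round, counted from 0, that colours [v]. *)
pose t v := (ex_minn (all_colored v)).-1.
have tP v : [/\ t v < k, v \in uncolored s (mark_all (t v)) &
    v \in s (mark_all (t v).+1)].
  rewrite /t; case: ex_minnP => -[|n] vn min_n.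
    by move: vn; rewrite /uncolored big_ord0 setC0 inE.
  have vW : v \in uncolored s (mark_all n).
    by apply: contraT => /min_n; rewrite ltnn.
  have /legal_history_rcons[legal_n _ _] := nzP _ _ vW.
  split=> //=; last by move: vn; rewrite /= uncolored_rcons inE vW andbT negbK.
  by have := win _ legal_n v vW; rewrite marks_mark_all.
have t_lt v : t v < k by case: (tP v).
apply/existsP; exists [ffun v => Ordinal (t_lt v)].
apply/forallP => x; apply/forallP => y; apply/implyP => exy; rewrite !ffunE.
apply/eqP => -[txy]; have [_ xW xs] := tP x; have [_ _ ys] := tP y.
have [_ /forall_inP/(_ x xs)/forall_inP/(_ y)] := legal_s _ _ (nzP _ _ xW).
by rewrite exy txy => /(_ ys).
Qed.

End LowerBound.

Lemma online_choosable_colorable (T : finType) (e : rel T) k :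
  online_choosable e k -> colorable e k.
Proof. by case=> s; apply: winning_colorable. Qed.

(** * Positions of the game and their quotas *)

Section Position.
Variables (T : finType) (e : rel T) (M : nat).
Hypothesis irr_e : irreflexive e.
Implicit Types (Q : {set {set T}}) (A B R S U W X : {set T}).
Implicit Types (c rk f : T -> nat) (v w z : T).

(* [before c rk w v]: w comes no later than v when singles are ordered by
   decreasing class, then by increasing rank; ties count against both. *)
Definition before c rk w v := (c v < c w) || (c v == c w) && (rk w <= rk v).
Definition pos A c rk v := #|[set w in A | before c rk w v]|.
Definition num_ge A c l := #|[set w in A | l <= c w]|.
Definition width Q l := \sum_(B in Q) maxn (#|B| - l) 1.
Definition load Q A c l := width Q l + num_ge A c l.
Definition quota Q A c i := #|Q| + \sum_(1 <= l < i) load Q A c l.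

(** [Q] holds the remainders, [A] the singles with classes [c] and ranks [rk], [W] the uncoloured
    vertices, [f] the colours left; [M] is the top class. The bound for [i] vertices of one
    remainder is [quota Q A c i], and [load] is its increment. *)
Record position Q A c rk W f : Prop := Position {
  position_sub : A \subset W;
  position_partition : partition Q (W :\: A);
  position_part B : B \in Q -> [/\ 1 < #|B|, #|B| <= M & independent e B];
  position_class v : v \in A -> c v <= M;
  position_single v : v \in A -> width Q (c v) + pos A c rk v <= f v;
  position_quota B S : B \in Q -> S \subset B -> S != set0 ->
    quota Q A c #|S| <= \sum_(v in S) f v }.

Lemma width_card Q l : (forall B, B \in Q -> #|B| <= l) -> width Q l = #|Q|.
Proof.
move=> leQ; rewrite /width -sum1_card; apply: eq_bigr => B /leQ; lia.
Qed.

Lemma width_remove Q B l : B \in Q ->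
  width Q l = maxn (#|B| - l) 1 + width (Q :\ B) l.
Proof. by move=> BQ; rewrite /width (big_setD1 B). Qed.

Lemma quota1 Q A c : quota Q A c 1 = #|Q|.
Proof. by rewrite /quota big_geq ?addn0. Qed.

Lemma quotaS Q A c i : 0 < i -> quota Q A c i.+1 = quota Q A c i + load Q A c i.
Proof. by move=> i0; rewrite /quota big_nat_recr //= addnA. Qed.

(** Each answer must lower the quotas enough to pay for the marks: [k] accounts for lost remainders,
    [d l] for the loss of load at [l]. *)
Lemma quota_drop Q A c Q' A' c' (k i : nat) (d : nat -> nat) :
  #|Q'| + k <= #|Q| ->
  (forall l, 1 <= l < i -> load Q' A' c' l + d l <= load Q A c l) ->
  quota Q' A' c' i + (k + \sum_(1 <= l < i) d l) <= quota Q A c i.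
Proof.
move=> leQ leD; rewrite /quota addnACA leq_add // -big_split /=.
by rewrite !big_nat; apply: leq_sum.
Qed.

Lemma sum_leq_nat i r : minn i.-1 r <= \sum_(1 <= l < i) (l <= r : nat).
Proof.
elim: i => [|[|i] IHi]; first by rewrite min0n.
  by rewrite min0n.
by rewrite big_nat_recr //=; case: leqP => /=; lia.
Qed.

Lemma sum_neq_nat i j : i.-1 - (j < i) <= \sum_(1 <= l < i) (l != j : nat).
Proof.
elim: i => [|[|i] IHi]; [by []|by lia|].
by rewrite big_nat_recr //=; case: eqVneq => /=; lia.
Qed.

(** Positivity makes the truncated subtraction in [spend] exact. *)
Lemma sum_spend S U f : (forall v, v \in S -> 0 < f v) ->
  \sum_(v in S) f v = \sum_(v in S) spend U f v + #|S :&: U|.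
Proof.
have -> : #|S :&: U| = \sum_(v in S) (v \in U).
  rewrite -sum1_card (eq_bigl _ _ (fun v => in_setI v S U)) big_mkcondr.
  by apply: eq_bigr => v _; case: (v \in U).
move=> f0; rewrite -big_split /=; apply: eq_bigr => v /f0.
by rewrite /spend; case: (v \in U); lia.
Qed.

(** * Bob's possible answers in one round *)

Section Step.
Variables (Q : {set {set T}}) (A : {set T}) (c rk : T -> nat) (W : {set T}).
Variable f : T -> nat.
Hypothesis posQ : position Q A c rk W f.

Lemma pos_gt0 v : v \in A -> 0 < pos A c rk v.
Proof.
move=> vA; rewrite card_gt0; apply/set0Pn; exists v.
by rewrite !inE vA /before eqxx leqnn orbT.
Qed.

Lemma part_sub B v : B \in Q -> v \in B -> v \in W /\ v \notin A.
Proof.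
move=> BQ vB; have := subsetP (partitionS (position_partition posQ) BQ) v vB.
by rewrite inE => /andP[].
Qed.

(** The quota of one vertex is the number of remainders, which is positive because [B] is one. *)
Lemma part_gt0 B v : B \in Q -> v \in B -> 0 < f v.
Proof.
move=> BQ vB; have := position_quota posQ (S := [set v]) BQ.
rewrite sub1set vB cards1 quota1 big_set1 => /(_ isT).
have: 0 < #|Q| by apply/card_gt0P; exists B.
have: [set v] != set0 by apply/set0Pn; exists v; rewrite inE.
by move=> -> q0 /(_ isT); apply: leq_trans.
Qed.

Lemma position_gt0 v : v \in W -> 0 < f v.
Proof.
move=> vW; have [vA|vA] := boolP (v \in A).
  by have := position_single posQ vA; have := pos_gt0 vA; lia.
have := cover_partition (position_partition posQ); move/setP/(_ v).
by rewrite inE vA vW => /bigcupP[B BQ]; apply: part_gt0.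
Qed.

Lemma spend_quota B S U q : B \in Q -> S \subset B ->
  q + #|S :&: U| <= \sum_(v in S) f v -> q <= \sum_(v in S) spend U f v.
Proof.
move=> BQ /subsetP sSB; rewrite (sum_spend U) ?leq_add2r // => v /sSB.
exact: part_gt0.
Qed.

Lemma card_removed B : B \in Q -> #|Q :\ B| + 1 <= #|Q|.
Proof. by move=> BQ; rewrite (cardsD1 B Q) BQ addnC. Qed.

(** Bookkeeping for colouring [B :\: R] and turning [R] into singles. *)
Lemma partition_remove B R : B \in Q -> R \subset B ->
  [/\ R :|: A \subset W :\: (B :\: R),
      partition (Q :\ B) (W :\: (B :\: R) :\: (R :|: A)) &
      forall B', B' \in Q :\ B -> B' \in Q].
Proof.
move=> BQ /subsetP sRB; split; last by move=> B' /setD1P[].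
  apply/subsetP => v; rewrite !inE => /orP[vR|vA].
    by rewrite vR; case: (part_sub BQ (sRB v vR)).
  rewrite (subsetP (position_sub posQ)) // andbT; apply: contraL vA => /andP[_].
  by case/(part_sub BQ).
suff ->: W :\: (B :\: R) :\: (R :|: A) = (W :\: A) :\: B.
  exact: partitionD1 (position_partition posQ) BQ.
apply/setP => v; rewrite !inE.
have [vR|] := boolP (v \in R); first by rewrite (sRB v vR).
by case: (v \in B); case: (v \in A).
Qed.

Variable U : {set T}.

Definition can_answer := exists X Q' A' c' rk',
  [/\ X \subset U, independent e X & position Q' A' c' rk' (W :\: X) (spend U f)].

(** Losing [B] lowers [#|Q|] and every width by at least 1, so the quota of [S] drops by at least
    [#|S|] and the bound of each single by at least 1. *)
Lemma answer_full B : B \in Q -> B \subset U -> can_answer.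
Proof.
move=> BQ sBU; have [] := partition_remove BQ (sub0set B).
rewrite set0U setD0 => sAW partQ sQ'.
exists B, (Q :\ B), A, c, rk; split=> //; first by case: (position_part posQ BQ).
split=> //.
- by move=> B' /sQ'/(position_part posQ).
- exact: position_class posQ.
- move=> v vA; have := position_single posQ vA; rewrite (width_remove _ BQ) /spend.
  by case: (v \in U); lia.
move=> B' S /sQ' BQ' sSB' S0; apply: (spend_quota BQ' sSB').
apply: leq_trans (position_quota posQ BQ' sSB' S0).
have := @quota_drop Q A c (Q :\ B) A c 1 #|S| (fun=> 1) (card_removed BQ).
rewrite sum_nat_const_nat muln1 => drop.
apply: leq_trans (drop _); last first.
  by move=> l _; rewrite /load (width_remove _ BQ); lia.
have := subset_leq_card (subsetIl S U); have: 0 < #|S| by rewrite card_gt0.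
lia.
Qed.

(* Since S attains its quota, each v of the same part has at least the increment
   [load |S|] of the quota left; marking cannot have spent any of it because the
   surviving vertices are unmarked. *)
Lemma answer_tight B S : B \in Q -> S \subset B :&: U -> S != set0 ->
    \sum_(v in S) f v = quota Q A c #|S| ->
    (forall B' S', B' \in Q -> S' \subset B' :&: U -> #|S| < #|S'| ->
       quota Q A c #|S'| < \sum_(v in S') f v) ->
  can_answer.
Proof.
move=> BQ; rewrite subsetI => /andP[sSB sSU] S0 tightS maxS.
have [_ _ indB] := position_part posQ BQ.
have [p_gt1 p_leM _] := position_part posQ BQ.
set R := B :\: U; set s := #|S|; set p := #|B|.
have s0 : 0 < s by rewrite card_gt0.
have sRB : R \subset B by apply: subsetDl.
have BU : B :\: R = B :&: U.
  by rewrite /R; apply/setP => v; rewrite !inE; case: (v \in B); case: (v \in U).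
have R_B v : v \in R -> v \in B by move/(subsetP sRB).
have cR : #|R| + s <= p.
  have := cardsID U B; rewrite -/R -/p => <-; rewrite addnC leq_add2r.
  by apply: subset_leq_card; rewrite subsetI sSB sSU.
have notAR v : v \in A -> v \notin B.
  by apply: contraL => /(part_sub BQ)[].
have fR v : v \in R -> load Q A c s <= f v.
  move=> vR; have vS : v \notin S.
    by apply: contraL vR => /(subsetP sSU); rewrite !inE => ->.
  have svB : v |: S \subset B by rewrite subUset sub1set R_B.
  have := position_quota posQ BQ svB; rewrite cardsU1 vS add1n quotaS //.
  rewrite big_setU1 //= tightS addnC leq_add2r; apply.
  by apply/set0Pn; exists v; rewrite !inE eqxx.
(* The new singles share one rank above all ranks in [A]: they come last in class [s] and count each
   other. *)
pose c' v := if v \in B then s else c v.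
pose rk' v := if v \in B then (\max_(w in A) rk w).+1 else rk v.
have [] := partition_remove BQ sRB; rewrite BU => sAW partQ sQ'.
exists (B :&: U), (Q :\ B), (R :|: A), c', rk'; split.
- exact: subsetIr.
- apply/forall_inP => x /setIP[xB _]; apply/forall_inP => y /setIP[yB _].
  by have /forall_inP/(_ x xB)/forall_inP/(_ y yB) := indB.
have cS v : v \in A -> c' v = c v by move=> /notAR/negPf vB; rewrite /c' vB.
have num_leq l : num_ge (R :|: A) c' l <= num_ge A c l + #|R| * (l <= s).
  rewrite /num_ge; have [le_ls|lt_sl] := leqP l s.
    rewrite muln1 addnC; apply: leq_trans (leq_card_setU _ _); apply: subset_leq_card.
    apply/subsetP => v; rewrite !inE => /andP[/orP[|vA]]; first by move=> ->.
    by rewrite cS // vA => ->; rewrite orbT.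
  rewrite muln0 addn0; apply: subset_leq_card; apply/subsetP => v.
  rewrite !inE => /andP[/orP[/andP[_ vB]|vA]]; first by rewrite /c' vB leqNgt lt_sl.
  by rewrite cS // vA.
(* Since [#|R| + s <= p], the lost width pays for the new singles, with at least 1 to spare when
   [l < s]; when [l > s] they are not counted at all. Only [l = s] may bring no gain. *)
have loadS l : 0 < l -> load (Q :\ B) (R :|: A) c' l + (l != s) <= load Q A c l.
  move=> l0; have := num_leq l; rewrite /load (width_remove _ BQ) -/p.
  by move: cR l0; case: (ltngtP l s) => /=; clear; lia.
split=> //.
- by move=> B' /sQ'/(position_part posQ).
- move=> v /setUP[/R_B vB|vA]; first by rewrite /c' vB; move: cR p_leM; clear; lia.
  by rewrite cS ?(position_class posQ).
- move=> v /setUP[vR|vA].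
    have vB := R_B _ vR; rewrite {1}/c' vB /spend.
    have -> : v \in U = false by move: vR; rewrite inE => /andP[/negPf].
    rewrite subn0; apply: leq_trans (fR v vR); rewrite /load (width_remove _ BQ) -/p.
    suff : pos (R :|: A) c' rk' v <= num_ge A c s + #|R|.
      by move: cR s0; clear; lia.
    have := num_leq s; rewrite leqnn muln1; apply: leq_trans.
    apply: subset_leq_card; apply/subsetP => w.
    rewrite !inE /before [c' v]/c' vB => /andP[-> /=].
    by case: ltngtP.
  have vB := negPf (notAR v vA); rewrite cS //; have := position_single posQ vA.
  rewrite (width_remove _ BQ) -/p /spend; have := leq_b1 (v \in U).
  (* The new singles precede [v] only if [c v < s], and then the lost width [p - c v] exceeds their
     number. *)
  suff : pos (R :|: A) c' rk' v <= pos A c rk v + #|R| * (c v < s).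
    by move: cR; case: ltnP; rewrite ?muln1 ?muln0 ?addn0; clear; lia.
  rewrite /pos; case: ltnP => [lt_cs|le_sc].
    rewrite muln1 addnC; apply: leq_trans (leq_card_setU _ _); apply: subset_leq_card.
    apply/subsetP => w; rewrite !inE => /andP[/orP[|wA]]; first by move=> ->.
    by rewrite /before !cS // /rk' vB (negPf (notAR w wA)) wA => ->; rewrite orbT.
  rewrite muln0 addn0; apply: subset_leq_card; apply/subsetP => w.
  rewrite !inE => /andP[/orP[/andP[_ wB]|wA]].
    rewrite /before /c' /rk' vB wB; have : rk v <= \max_(w in A) rk w by apply: leq_bigmax_cond.
    by move: le_sc; clear; lia.
  by rewrite /before !cS // /rk' vB (negPf (notAR w wA)) wA.
move=> B' S' /sQ' BQ' sSB' S'0; apply: (spend_quota BQ' sSB').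
have quotaS' := position_quota posQ BQ' sSB' S'0.
have := @quota_drop Q A c (Q :\ B) (R :|: A) c' 1 #|S'| (fun l => (l != s))
  (card_removed BQ).
have drop_l l : 0 < l < #|S'| ->
    load (Q :\ B) (R :|: A) c' l + (l != s) <= load Q A c l.
  by case/andP=> l0 _; apply: loadS.
move/(_ drop_l); have := sum_neq_nat #|S'| s.
have S'_gt0 : 0 < #|S'| by rewrite card_gt0.
(* The quota drops by at least [#|S'|], or [#|S'| - 1] if [s < #|S'|]. In the latter case the
   missing unit is slack by maximality of [S], or some vertex of [S'] is unmarked. *)
have [sSU'|nSU'] := boolP (S' \subset U).
  have := maxS B' S' BQ'; rewrite subsetI sSB' sSU' -/s => /(_ isT).
  by rewrite (setIidPl sSU'); move: quotaS' S'_gt0; case: ltnP => /=; clear; lia.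
have : #|S' :&: U| < #|S'|.
  by apply: proper_card; rewrite properE subsetIl subsetI subxx.
by move: quotaS' S'_gt0; case: ltnP => /=; clear; lia.
Qed.

Hypothesis no_tight : forall B S, B \in Q -> S \subset B :&: U -> S != set0 ->
  quota Q A c #|S| < \sum_(v in S) f v.
Variable r : nat.
Hypothesis le_r : forall B, B \in Q -> #|B :&: U| <= r.

(** A fully marked [S] has one colour of slack, as no marked set is tight; any other [S] loses fewer
    than [#|S|] colours. In both cases at most [r] are lost. *)
Lemma quota_slack B S (q k : nat) : B \in Q -> S \subset B -> S != set0 ->
  q + (k + minn #|S|.-1 (r - k)) <= quota Q A c #|S| -> k <= 1 ->
  q <= \sum_(v in S) spend U f v.
Proof.
move=> BQ sSB S0 drop k1; apply: (spend_quota BQ sSB).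
have S_gt0 : 0 < #|S| by rewrite card_gt0.
have := leq_trans (subset_leq_card (setSI U sSB)) (le_r BQ).
have := position_quota posQ BQ sSB S0.
have [sSU|nSU] := boolP (S \subset U).
  have := no_tight (S := S) BQ; rewrite subsetI sSB sSU S0 => /(_ isT isT).
  by rewrite (setIidPl sSU); move: drop k1 S_gt0; clear; lia.
have : #|S :&: U| < #|S|.
  by apply: proper_card; rewrite properE subsetIl subsetI subxx.
by move: drop k1 S_gt0; clear; lia.
Qed.

(** Colouring a first marked single [z] of class at least [r] moves up all singles it precedes,
    including all other marked ones. It also lowers the load at each [l <= c z], hence at each
    [l <= r]. *)
Lemma answer_single v : v \in A :&: U -> r <= c v -> can_answer.
Proof.
move=> vAU le_rv; pose cand w := (w \in A :&: U) && (r <= c w).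
have cand_v : cand v by rewrite /cand vAU.
case: (arg_minnP (pos A c rk) cand_v) => z /andP[/setIP[zA zU] le_rz] min_z.
have before_or w : w \in A -> before c rk z w \/ w \notin U.
  move=> wA; have [|nzw] := boolP (before c rk z w); [by left | right].
  apply/negP => wU.
  have le_zw : c z <= c w by move: nzw; rewrite /before negb_or -leqNgt => /andP[].
  (* A marked [w] strictly ahead of [z] would also be a candidate, with a smaller position. *)
  have := min_z w; rewrite /cand inE wA wU (leq_trans le_rz le_zw) => /(_ isT).
  rewrite leqNgt => /negP[]; apply: proper_card; rewrite properE.
  apply/andP; split.
    apply/subsetP => x; rewrite !inE => /andP[->].
    by move: nzw; rewrite /before; clear; lia.
  apply/subsetPn; exists z; rewrite !inE zA ?(negPf nzw) //.
  by rewrite /before eqxx leqnn orbT.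
have zW := subsetP (position_sub posQ) z zA.
exists [set z], Q, (A :\ z), c, rk; split; first by rewrite sub1set.
  apply/forall_inP => x /set1P ->; apply/forall_inP => y /set1P ->.
  by rewrite irr_e.
split.
- by rewrite setSD ?(position_sub posQ).
- suff -> : W :\ z :\: (A :\ z) = W :\: A by exact: position_partition posQ.
  by apply/setP => x; rewrite !inE; case: eqVneq => // ->; rewrite zA.
- exact: position_part posQ.
- by move=> w /setD1P[_ wA]; apply: (position_class posQ wA).
- move=> w /setD1P[neq_wz wA]; have := position_single posQ wA; rewrite /spend.
  have le_pos : pos (A :\ z) c rk w + before c rk z w = pos A c rk w.
    rewrite /pos [RHS](cardsD1 z) !inE zA addnC /=; congr addn.
    by apply: eq_card => x; rewrite !inE andbA.
  have := leq_b1 (w \in U); rewrite -le_pos.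
  by case: (before_or w wA) => [->|/negPf ->]; clear; lia.
move=> B S BQ sSB S0; apply: (quota_slack (k := 0) BQ) => //.
have := @quota_drop Q A c Q (A :\ z) c 0 #|S| (fun l => l <= c z).
rewrite addn0 leqnn => /(_ isT) drop; apply: leq_trans (drop _).
  rewrite leq_add2l add0n subn0; apply: leq_trans (sum_leq_nat _ _).
  by move: le_rz; clear; lia.
move=> l _; rewrite /load /num_ge [X in _ <= _ + X](cardsD1 z) !inE zA /=.
rewrite -addnA leq_add2l addnC leq_add2l; apply: subset_leq_card.
by apply/subsetP => x; rewrite !inE -andbA.
Qed.

Hypothesis no_single : forall v, v \in A :&: U -> c v < r.

(** As at least two vertices stay, the width drops at every [l <= r]. This pays for the quotas and
    for the marked singles, all of class below [r]. *)
Lemma answer_shrink B : B \in Q -> #|B :&: U| = r -> 0 < r ->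
  1 < #|B :\: U| -> can_answer.
Proof.
move=> BQ cBU r0 R1; set R := B :\: U.
have cB : #|B| = #|R| + r by rewrite -(cardsID U B) cBU addnC.
have [_ leM indB] := position_part posQ BQ.
have sRB : R \subset B by apply: subsetDl.
have BU : B :\: (B :&: U) = R.
  by rewrite /R; apply/setP => v; rewrite !inE; case: (v \in B); case: (v \in U).
have [_ partQ sQ'] := partition_remove BQ (sub0set B).
rewrite setD0 set0U in partQ.
have disRW : [disjoint R & W :\: B :\: A].
  rewrite -setI_eq0; apply/eqP/setP => v; rewrite !inE.
  by case: (v \in B); rewrite ?andbF.
have R_neq0 : R != set0 by rewrite -card_gt0; apply: ltnW.
have partQ' := partitionU1 partQ R_neq0 disRW.
have RQ : R \notin Q :\ B.
  apply/negP => RQ; have [v vR] := set0Pn _ R_neq0.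
  by have := subsetP (partitionS partQ RQ) v vR; rewrite !inE (subsetP sRB v vR) andbF.
have widthS l : width (R |: Q :\ B) l + (l <= r) <= width Q l.
  rewrite (width_remove _ BQ) /width big_setU1 //= addnAC leq_add2r cB.
  by move: r0 R1; rewrite -/R; case: leqP => /=; clear; lia.
have subQ B' : B' \in R |: Q :\ B -> exists2 B0, B0 \in Q & B' \subset B0.
  by case/setU1P => [->|/sQ' BQ']; [exists B | exists B'].
exists (B :&: U), (R |: Q :\ B), A, c, rk; split.
- exact: subsetIr.
- apply/forall_inP => x /setIP[xB _]; apply/forall_inP => y /setIP[yB _].
  by have /forall_inP/(_ x xB)/forall_inP/(_ y yB) := indB.
split.
- apply/subsetP => v vA; rewrite !inE (subsetP (position_sub posQ)) // andbT.
  by apply: contraL vA => /andP[/(part_sub BQ)[]].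
- suff -> : W :\: B :&: U :\: A = R :|: (W :\: B :\: A) by [].
  apply/setP => v; rewrite !inE; have [vB|_] := boolP (v \in B); last first.
    by rewrite andbF.
  by have [-> ->] := part_sub BQ vB; rewrite !andbT orbF.
- move=> B' /setU1P[->|/sQ'/(position_part posQ)//]; split=> //.
    exact: leq_trans (subset_leq_card sRB) leM.
  apply/forall_inP => x /(subsetP sRB) xB; apply/forall_inP => y /(subsetP sRB) yB.
  by have /forall_inP/(_ x xB)/forall_inP/(_ y yB) := indB.
- exact: position_class posQ.
- move=> v vA; have := position_single posQ vA; have := widthS (c v); rewrite /spend.
  case: (boolP (v \in U)) => vU /=; last by clear; lia.
  have := no_single (v := v); rewrite inE vA vU => /(_ isT); clear.
  by case: (leqP (c v) r) => /=; lia.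
move=> B' S /subQ[B0 BQ0 sB'] sSB S0.
apply: (quota_slack (k := 0) BQ0 (subset_trans sSB sB')) => //.
have := @quota_drop Q A c (R |: Q :\ B) A c 0 #|S| (fun l => l <= r).
have -> : #|R |: Q :\ B| + 0 <= #|Q|.
  by rewrite cardsU1 RQ addn0 addnC card_removed.
move=> /(_ isT) drop; apply: leq_trans (drop _).
  by rewrite leq_add2l add0n subn0 sum_leq_nat.
by move=> l _; rewrite /load addnAC leq_add2r.
Qed.

(** Removing [B] lowers the width by at least 2 at each [l < r] and by 1 beyond; the new single
    takes back 1. The surplus below [r] and the lost remainder pay for the marks. *)
Lemma answer_last B : B \in Q -> #|B :&: U| = r -> 0 < r ->
  #|B :\: U| = 1 -> can_answer.
Proof.
move=> BQ cBU r0 R1.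
have cB : #|B| = r.+1 by rewrite -(cardsID U B) cBU R1 addn1.
have [_ leM indB] := position_part posQ BQ.
have [z Rz] : exists z, B :\: U = [set z] by apply/cards1P; rewrite R1.
have /setDP[zB zU] : z \in B :\: U by rewrite Rz inE.
have [_ zA] := part_sub BQ zB.
have BU : B :\ z = B :&: U.
  rewrite -Rz; apply/setP => v; rewrite !inE.
  by case: (v \in B); case: (v \in U).
have [] := @partition_remove B [set z] BQ; first by rewrite sub1set.
rewrite BU => sAW partQ sQ'.
(* z has only #|Q| colours guaranteed, so it must go first among the singles. *)
pose c' v := if v == z then M else c v.
pose rk' v := if v == z then 0 else (rk v).+1.
have neq_z v : v \in A -> v == z = false.
  by move=> vA; apply: contraTF vA => /eqP ->.
have widthS l : width (Q :\ B) l + maxn (r.+1 - l) 1 = width Q l.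
  by rewrite (width_remove _ BQ) cB addnC.
have num_leq l : num_ge (z |: A) c' l <= num_ge A c l + 1.
  rewrite addnC -(cards1 z); apply: leq_trans (leq_card_setU _ _).
  apply: subset_leq_card; apply/subsetP => v; rewrite !inE /c'.
  by case: eqVneq.
exists (B :&: U), (Q :\ B), (z |: A), c', rk'; split.
- exact: subsetIr.
- apply/forall_inP => x /setIP[xB _]; apply/forall_inP => y /setIP[yB _].
  by have /forall_inP/(_ x xB)/forall_inP/(_ y yB) := indB.
split=> //.
- by move=> B' /sQ'/(position_part posQ).
- move=> v; rewrite !inE /c'; case: eqVneq => //= _ vA; exact: (position_class posQ vA).
- move=> v /setU1P[->|vA].
    rewrite /spend (negPf zU) subn0 {1}/c' eqxx.
    (* In class [M] each remainder contributes 1, so [z] needs [#|Q| - 1] colours plus its position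
       1. *)
    rewrite width_card; last by move=> B' /sQ'/(position_part posQ)[].
    have pos_z : pos (z |: A) c' rk' z = 1.
      rewrite /pos -(cards1 z); apply: eq_card => x; rewrite !inE /before /c' /rk' eqxx.
      case: eqVneq => [_|_] /=; first by rewrite eqxx leqnn orbT.
      rewrite ltn0 andbF orbF; apply/negP => /andP[xA].
      by rewrite ltnNge (position_class posQ).
    rewrite pos_z; apply: leq_trans (card_removed BQ) _.
    have := @position_quota _ _ _ _ _ _ posQ B [set z] BQ.
    rewrite sub1set zB cards1 quota1 big_set1; apply=> //.
    by apply/set0Pn; exists z; rewrite inE.
  have := position_single posQ vA; rewrite -widthS {1}/c' neq_z //.
  have : pos (z |: A) c' rk' v <= pos A c rk v + 1.
    rewrite addnC -(cards1 z); apply: leq_trans (leq_card_setU _ _).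
    apply: subset_leq_card; apply/subsetP => w; rewrite !inE /before /c' /rk' (neq_z v) //.
    by case: eqVneq.
  rewrite /spend; have [vU|_] := boolP (v \in U); last by clear; lia.
  by have := no_single (v := v); rewrite inE vA vU => /(_ isT); clear; lia.
move=> B' S /sQ' BQ' sSB S0; apply: (quota_slack (k := 1) BQ' sSB) => //.
have := @quota_drop Q A c (Q :\ B) (z |: A) c' 1 #|S| (fun l => l <= r.-1).
rewrite (card_removed BQ) => /(_ isT) drop; apply: leq_trans (drop _).
  by rewrite leq_add2l leq_add2l subn1 sum_leq_nat.
move=> l /andP[l0 _]; have := num_leq l; rewrite /load -widthS.
by move: l0 r0; case: leqP => /=; clear; lia.
Qed.

End Step.

(** * Choosing the answer *)

Lemma position_answer Q A c rk W f U : position Q A c rk W f ->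
  U \subset W -> U != set0 -> can_answer W f U.
Proof.
move=> posQ sUW U0.
have [/exists_inP[B BQ sBU]|] := boolP [exists B in Q, B \subset U].
  exact: answer_full posQ _ _ BQ sBU.
rewrite negb_exists_in => /forall_inP not_full.
pose tight S := [&& S != set0, [exists B in Q, S \subset B :&: U] &
  \sum_(v in S) f v <= quota Q A c #|S|].
have [/existsP[S0 tightS0]|no_tight] := boolP [exists S, tight S].
  case: (arg_maxnP (fun S : {set T} => #|S|) tightS0) => S.
  case/and3P=> S_neq0 /exists_inP[B BQ sSBU] le_quota maxS.
  apply: (answer_tight posQ BQ sSBU S_neq0).
    apply/eqP; rewrite eqn_leq le_quota (position_quota posQ BQ) //.
    by apply: subset_trans sSBU (subsetIl _ _).
  move=> B' S' BQ' sSB' ltS; rewrite ltnNge; apply/negP => le_quota'.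
  have tightS' : tight S'; last by have := maxS S' tightS'; rewrite /= leqNgt ltS.
  rewrite /tight le_quota' andbT -card_gt0 (leq_trans _ ltS) //.
  by apply/exists_inP; exists B'.
have {}no_tight B S : B \in Q -> S \subset B :&: U -> S != set0 ->
    quota Q A c #|S| < \sum_(v in S) f v.
  move=> BQ sSB S0; rewrite ltnNge; apply: contra no_tight => le_quota.
  apply/existsP; exists S; rewrite /tight S0 le_quota andbT.
  by apply/exists_inP; exists B.
pose r := \max_(B in Q) #|B :&: U|.
have le_r B : B \in Q -> #|B :&: U| <= r by move=> BQ; apply: leq_bigmax_cond.
have [/exists_inP[v vAU le_rv]|] := boolP [exists v in A :&: U, r <= c v].
  exact: (answer_single posQ no_tight le_r vAU).
rewrite negb_exists_in => /forall_inP no_single.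
have {}no_single v : v \in A :&: U -> c v < r by move/no_single; rewrite ltnNge.
(* Some vertex is marked: a single has class below [r], and a vertex of a remainder counts towards
   [r]. *)
have r0 : 0 < r.
  have [v vU] := set0Pn _ U0; have [vA|vA] := boolP (v \in A).
    by apply: leq_ltn_trans (no_single v _); rewrite // inE vA.
  have := cover_partition (position_partition posQ); move/setP/(_ v).
  rewrite inE vA (subsetP sUW) // => /bigcupP[B BQ vB].
  apply: leq_trans (le_r _ BQ); rewrite card_gt0; apply/set0Pn; exists v.
  by rewrite inE vB.
have Q0 : 0 < #|Q|.
  rewrite card_gt0; apply: contraTneq r0 => Q0.
  by rewrite /r Q0 big_set0.
have [B BQ r_B] := eq_bigmax_cond (fun B => #|B :&: U|) Q0.
have R0 : 0 < #|B :\: U| by rewrite card_gt0 setD_eq0 not_full.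
have [R1|R1] := ltnP 1 #|B :\: U|.
  exact: (answer_shrink posQ no_tight le_r no_single BQ).
apply: (answer_last posQ no_tight le_r no_single BQ) => //.
by apply/eqP; rewrite eqn_leq R1.
Qed.

End Position.

(** * The initial position *)

(** The excess of [maxn (b - l) 1] over 1 is ['C(b - l, 2) - 'C(b - l.+1, 2)], so the sum
    telescopes. *)
Lemma sum_maxn_bound b i : 0 < i ->
  \sum_(1 <= l < i) maxn (b - l) 1 + 'C(b - i, 2) <= i.-1 + 'C(b.-1, 2).
Proof.
case: i => // i _; elim: i => [|i IHi]; first by rewrite big_geq // subn1.
rewrite big_nat_recr //=; move: IHi; rewrite /= !subnS.
case: (b - i)%N => [|[|n]] /=; rewrite ?binS ?bin1 ?bin0n /=; lia.
Qed.

Section PartsBound.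
Variables (T : finType) (e : rel T) (P : {set {set T}}).
Hypothesis irr_e : irreflexive e.
Hypothesis partP : partition P [set: T].
Hypothesis indP : forall B, B \in P -> independent e B.

Lemma online_choosable_parts :
  \sum_(B in P) 'C(#|B|.-1, 2) <= #|[set B in P | #|B| == 1]| ->
  online_choosable e #|P|.
Proof.
set P1 := [set B in P | #|B| == 1]; set Q := [set B in P | 1 < #|B|] => bound.
have tP := partition_trivIset partP.
have P_gt0 B : B \in P -> 0 < #|B|.
  by move=> BP; rewrite card_gt0 (partition_neq0 partP).
have sP1 : P1 \subset P by apply/subsetP => B /setIdP[].
have sQ : Q \subset P by apply/subsetP => B /setIdP[].
have PD : P :\: P1 = Q.
  apply/setP => B; rewrite !inE; case: (boolP (B \in P)) => [/P_gt0|_].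
    by case: #|B| => [|[|n]].
  by rewrite andbF.
have part1 : partition P1 (cover P1).
  rewrite /partition eqxx (trivIsetS sP1 tP) /=.
  by apply/negP => /(subsetP sP1)/P_gt0; rewrite cards0.
have card1 : #|cover P1| = #|P1|.
  rewrite -[RHS]muln1; apply: card_uniform_partition part1.
  by move=> B /setIdP[_ /eqP].
have partQ : partition Q ([set: T] :\: cover P1).
  apply/and3P; split.
  - apply/eqP/setP => v; rewrite !inE andbT.
    have := cover_partition partP; move/setP/(_ v); rewrite inE => /bigcupP[B BP vB].
    apply/bigcupP/negP => [[B' /setIdP[BP' B'1] vB']|].
      case/bigcupP=> B0 /setIdP[BP0 /eqP B0_1] vB0.
      move: B'1; rewrite -(def_pblock tP BP' vB') (def_pblock tP BP0 vB0).
      by rewrite B0_1.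
    move=> nP1; exists B => //; rewrite inE BP ltn_neqAle P_gt0 // andbT eq_sym.
    by apply/negP => B1; apply: nP1; apply/bigcupP; exists B; rewrite // inE BP.
  - exact: trivIsetS sQ tP.
  - by apply/negP => /(subsetP sQ)/P_gt0; rewrite cards0.
have cP : #|P| = #|P1| + #|Q| by rewrite -(cardsID P1 P) PD (setIidPr sP1).
pose M := \max_(B in P) #|B|.
have leM B : B \in P -> #|B| <= M by move=> BP; apply: leq_bigmax_cond.
pose inv W f := exists Q A c rk, position e M Q A c rk W f.
apply: (@inv_online_choosable _ _ inv).
- by move=> W f v [Q' [A' [c' [rk' posQ]]]]; apply: (position_gt0 posQ).
- move=> W U f [Q' [A' [c' [rk' posQ]]]] sUW U0.
  have [X [Q'' [A'' [c'' [rk'' [sXU iX posX]]]]]] :=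
    position_answer irr_e posQ sUW U0.
  by exists X; split=> //; exists Q'', A'', c'', rk''.
(* All singles are tied at first, so each has position at most [#|P1|]. *)
exists Q, (cover P1), (fun=> M), (fun=> 0); split=> //.
- by move=> B /setIdP[BP B1]; rewrite B1 leM ?indP.
- move=> v v1; rewrite width_card => [|B /(subsetP sQ)/leM//].
  rewrite cP addnC leq_add2r -card1; apply: subset_leq_card.
  by apply/subsetP => w /setIdP[].
move=> B S /(subsetP sQ) BP sSB S0; rewrite sum_nat_const cP /quota.
set i := #|S|; have i0 : 0 < i by rewrite card_gt0.
(* The total excess of the widths over [#|Q|] is at most the sum of binomials, hence at most
   [#|P1|]. *)
have width_i : \sum_(1 <= l < i) width Q l <= i.-1 * #|Q| + #|P1|.
  apply: leq_trans (leq_add (leqnn _) bound).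
  rewrite exchange_big /= [X in _ <= _ + X](big_setID P1) /= PD mulnC -sum_nat_const.
  rewrite addnCA -big_split /=; apply: leq_trans (leq_addl _ _); apply: leq_sum => B' _.
  exact: leq_trans (leq_addr _ _) (sum_maxn_bound _ i0).
have load_i : \sum_(1 <= l < i) load Q (cover P1) (fun=> M) l <=
    \sum_(1 <= l < i) width Q l + i.-1 * #|P1|.
  rewrite /load big_split leq_add2l -card1 -subn1 -sum_nat_const_nat.
  apply: leq_sum => l _; apply: subset_leq_card.
  by apply/subsetP => w /setIdP[].
by move: i0 width_i load_i; clear; nia.
Qed.

End PartsBound.

(** * Colourings and part sizes of complete multipartite graphs *)

Section CompleteMultipartite.
Variables (T : finType) (e : rel T) (P : {set {set T}}).
Hypothesis multiP : complete_multipartite e P.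

Lemma multipartite_independent B : B \in P -> independent e B.
Proof.
case: multiP => partP eP BP; have tP := partition_trivIset partP.
apply/forall_inP => x xB; apply/forall_inP => y yB.
by rewrite eP !(def_pblock tP BP) ?eqxx.
Qed.

(** A transversal of the parts is a clique, so a proper colouring is injective on it. *)
Lemma colorable_card_parts k : colorable e k -> #|P| <= k.
Proof.
case: multiP => partP eP /existsP[col /forallP colP].
have trX := transversalP partP.
rewrite -(card_transversal trX) -[k]card_ord -(card_in_imset (f := col)) ?max_card //.
move=> x y xX yX /eqP; apply: contraTeq => neq_xy.
have /forallP/(_ y) := colP x; rewrite eP.
by rewrite (inj_in_eq (pblock_inj trX)) // neq_xy.
Qed.

Lemma sum_parts_of_size (m : nat) (F : nat -> nat) :
  (forall B, B \in P -> #|B| <= m) ->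
  \sum_(p < m.+1) F p * parts_of_size P p = \sum_(B in P) F #|B|.
Proof.
move=> leP; rewrite (partition_big (fun B : {set T} => inord #|B| : 'I_m.+1) xpredT) //=.
apply: eq_bigr => p _; rewrite mulnC -sum_nat_const; apply: eq_big => [B|B].
  rewrite inE; case: (boolP (B \in P)) => //= /leP leB.
  by rewrite -val_eqE /= inordK.
by move=> /setIdP[_ /eqP ->].
Qed.

End CompleteMultipartite.

(** * The numerical hypothesis and the conclusion *)

Local Open Scope ring_scope.

(** The coefficient in the hypothesis is [(p - 1)(p - 2) / 2]. *)
Lemma bin2_rat p : (0 < p)%N ->
  ('C(p.-1, 2))%:R = p%:R ^+ 2 / 2 - 3 * p%:R / 2 + 1 :> rat.
Proof.
case: p => [|[|p]] //= _.
have /(congr1 (fun n => n%:R : rat)) := mul_bin_diag p.+1 1.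
by rewrite bin1 !natrM /= -[p.+2]addn2 -[p.+1 in X in X * _ = _]addn1 !natrD; lra.
Qed.

Theorem theorem7 (T : finType) (e : rel T) (He : simple_graph e)
    (P : {set {set T}}) (HP : complete_multipartite e P)
    (m : nat) (Hm : independence_number e = m) (m_ge2 : (2 <= m)%N) :
  0 <= (parts_of_size P 1)%:R
       - \sum_(2 <= p < m.+1)
           (p%:R ^+ 2 / 2 - 3 * p%:R / 2 + 1) * (parts_of_size P p)%:R :> rat ->
  online_chromatic_choosable He.
Proof.
move=> bound; have [partP eP] := HP; have indP := multipartite_independent HP.
have leP B : B \in P -> (#|B| <= m)%N.
  by move=> /indP indB; rewrite -Hm /independence_number; apply: leq_bigmax_cond.
have choosableP : online_choosable e #|P|.
  apply: online_choosable_parts partP indP _; first by case: He.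
  rewrite -(sum_parts_of_size (fun p => 'C(p.-1, 2)) leP) -(ler_nat rat) -subr_ge0.
  congr (0 <= _): bound; congr (_ - _); rewrite natr_sum.
  rewrite -(big_mkord xpredT (fun p => ('C(p.-1, 2) * parts_of_size P p)%:R)).
  (* The terms for sizes 0 and 1 vanish, so the sum may start at 2. *)
  rewrite [RHS]big_ltn // [X in _ = _ + X]big_ltn ?ltnS 1?ltnW // !mul0n !add0r.
  by apply: eq_big_nat => p /andP[p2 _]; rewrite natrM bin2_rat // ltnW.
rewrite /online_chromatic_choosable /online_choice_number /chromatic_number.
case: ex_minnP => a /asboolP chooseA min_a; case: ex_minnP => b colB min_b.
(* The cycle [b <= a <= #|P| <= b] gives equality. *)
apply/eqP; rewrite eqn_leq min_b ?online_choosable_colorable // andbT.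
apply: leq_trans (colorable_card_parts HP colB).
by apply: min_a; apply/asboolP.
Qed.
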